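(* Assume that there exists a sequence $(\Gamma_n)_{n\in\mathbb N_0}$ of strictly decreasing lattices $\Gamma_0\supsetneq\Gamma_1\supsetneq\dots$ in $G$. Then, given any $\epsilon>0$, there exist a system $\mathcal L=(\Lambda_i)_{i\in I}$ of lattices in $G$ with $$BW(\mathcal L):=\sum_{i\in I}\frac1{\operatorname{covol}(\Lambda_i)}<\epsilon,$$ and a system of functions $(h_i)_{i\in I}\subset L^2(G)$ such that the associated generalized shift-invariant system $(T_\lambda h_i)_{i\in I,\lambda\in\Lambda_i}$ is an orthonormal basis of $L^2(G)$.
   Context: $G$ is a second countable locally compact abelian group, written additively, with Haar measure $\mu_G$. A lattice in $G$ is a discrete subgroup $\Gamma$ with $G/\Gamma$ compact; $\operatorname{covol}(\Gamma)$ is the $\mu_G$-measure of any fundamental domain of $\Gamma$ (a Borel set whose $\Gamma$-translates tile $G$ up to null sets). $T_\lambda f=f(\cdot-\lambda)$. Systems of lattices are indexed by countable sets. *)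

(* Defs.v *)
From HB Require Import structures.
From mathcomp Require Import all_boot all_order all_algebra.
From mathcomp Require Import ring_quotient complex.
From mathcomp Require Import all_classical all_reals all_analysis.

Set Implicit Arguments.
Unset Strict Implicit.
Unset Printing Implicit Defensive.
Import Order.TTheory GRing.Theory Num.Theory.
Local Open Scope classical_set_scope.
Local Open Scope ring_scope.

(* G with its Borel sigma-algebra.  The library generates sigma-algebras on
   pointed types only; 0 serves as the point. *)
Definition borelType (G : topologicalZmodType) : Type := G.

HB.instance Definition _ (G : topologicalZmodType) :=
  TopologicalZmodule.on (borelType G).
HB.instance Definition _ (G : topologicalZmodType) :=
  isPointed.Build (borelType G) 0.
HB.instance Definition _ (G : topologicalZmodType) :=
  Measurable.copy (borelType G) (g_sigma_algebraType (@open (borelType G))).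

(* Nonzero translation-invariant Radon measure. *)
Record haar_measure (R : realType) (G : topologicalZmodType)
    (mu : {measure set (borelType G) -> \bar R}) : Prop := HaarMeasure {
  haar_neq0 : mu setT <> 0%E ;
  haar_translation : forall (x : G) (A : set (borelType G)), measurable A ->
    mu [set x + y | y in A] = mu A ;
  haar_compact : forall K : set (borelType G), compact K -> (mu K < +oo)%E ;
  haar_outer_regular : forall A : set (borelType G), measurable A ->
    mu A = ereal_inf [set mu U | U in [set U | open U /\ A `<=` U]] ;
  haar_inner_regular : forall U : set (borelType G), open U ->
    mu U = ereal_sup [set mu K | K in [set K | compact K /\ K `<=` U]]
}.

(* [zmodClosed G] is the library's type of subgroups of the additive group G. *)
Section Lattices.
Variable G : topologicalZmodType.
Implicit Types Gam : zmodClosed G.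

Definition discrete_subgroup Gam : Prop :=
  forall x, x \in Gam -> exists2 U, nbhs x U & U `&` [set` Gam] = [set x].

Definition lattice Gam : Prop :=
  discrete_subgroup Gam /\
  compact [set: quotient_topology (Quotient.quot Gam)].

Variables (R : realType) (mu : {measure set (borelType G) -> \bar R}).

Definition translate (x : G) (A : set (borelType G)) : set (borelType G) :=
  [set x + y | y in A].

Definition fundamental_domain Gam (F : set (borelType G)) : Prop :=
  [/\ measurable F,
      {in Gam &, forall x y, x != y ->
         mu.-negligible (translate x F `&` translate y F)} &
      mu.-negligible (~` \bigcup_(x in [set` Gam]) translate x F)].

(* All fundamental domains of a lattice have the same measure.  The default
   value 0 (hence 1 / covol = +oo) is used only if there is none. *)
Definition covol Gam : \bar R :=
  xget 0%E [set mu F | F in [set F | fundamental_domain Gam F]].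

Definition BW (I : countType) (Lam : I -> zmodClosed G) : \bar R :=
  \esum_(i in [set: I]) (covol (Lam i))^-1%E.

End Lattices.

(* Elements of the complex L^2 are given by representatives: all the notions
   below are invariant under almost everywhere equality. *)
Section ComplexL2.
Variables (R : realType) (G : topologicalZmodType).
Variable mu : {measure set (borelType G) -> \bar R}.
Implicit Types f g : borelType G -> R[i].

Definition L2norm f : \bar R :=
  ('N[mu]_2%:E[(fun x => (Normc.normc (f x))%:E)])%E.

Definition L2 f : Prop :=
  [/\ measurable_fun setT (fun x => complex.Re (f x)),
      measurable_fun setT (fun x => complex.Im (f x)) &
      (L2norm f < +oo)%E].

Definition cintegral f : R[i] :=
  Complex (\int[mu]_x complex.Re (f x)) (\int[mu]_x complex.Im (f x)).

Definition inner f g : R[i] := cintegral (fun x => f x * (g x)^*).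

Definition orthonormal_basis (J : eqType) (e : J -> borelType G -> R[i]) :
    Prop :=
  [/\ forall j, L2 (e j),
      forall j k, inner (e j) (e k) = (j == k)%:R &
      forall f, L2 f -> forall eps : R, 0 < eps ->
        exists s : seq (R[i] * J),
          (L2norm (fun x => f x - \sum_(p <- s) p.1 * e p.2 x)%R
             < eps%:E)%E].

End ComplexL2.

Definition translation (R : realType) (G : topologicalZmodType) (lam : G)
  (f : borelType G -> R[i]) : borelType G -> R[i] := fun x => f (x - lam).

(* The index set of the system is the set of pairs (i, lam), lam in Lam i. *)
Definition gsi_index (G : topologicalZmodType) (I : countType)
  (Lam : I -> zmodClosed G) := {i : I & {lam : G | lam \in Lam i}}.

Definition gsi_system (R : realType) (G : topologicalZmodType) (I : countType)
    (Lam : I -> zmodClosed G) (h : I -> borelType G -> R[i])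
    (j : gsi_index Lam) : borelType G -> R[i] :=
  translation (val (tagged j)) (h (tag j)).

(* Main.v *)
Require Import Defs.
From HB Require Import structures.
From mathcomp Require Import all_boot all_order all_algebra.
From mathcomp Require Import ring_quotient complex.
From mathcomp Require Import all_classical all_reals all_analysis.
From mathcomp Require Import measurable_realfun ring lra.

Set Implicit Arguments.
Unset Strict Implicit.
Unset Printing Implicit Defensive.
Import Order.TTheory GRing.Theory Num.Theory.
Import numFieldNormedType.Exports.
Local Open Scope classical_set_scope.
Local Open Scope ring_scope.

(** Why a system of lattices of arbitrarily small total density suffices.

    Let F be a Borel transversal of Gam 0 and (e j) an orthonormal basis of
    L^2(F), extended by zero.  The translates of F by Gam 0 tile G, so the
    functions T_a (e j), with a in Gam 0, form an orthonormal basis of L^2(G).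
    The generalized shift-invariant system is this very basis with another
    indexing.  For each j, the group Gam 0 is partitioned into countably many
    cosets g n + Gam (n + j + c), and the vectors T_a (e j) with a in one such
    coset are the translates of T_(g n) (e j) by the lattice Gam (n + j + c).
    Unlike a partition into finitely many cosets, whose densities add up to
    the density of Gam 0, a countable one may have total density as small as
    desired.

    The partition is greedy (fresh_cosets_cover, fresh_cosets_disjoint):
    enumerate Gam 0 as (g n), and let g n open the coset g n + Gam (n + j + c)
    unless an earlier coset contains it.  As the levels n + j + c increase
    with n, a later coset is included in an earlier one or disjoint from it.

    Each step of the chain at least doubles the covolume, so covol (Gam m) is
    at least c0 * 2 ^ m for some c0 > 0 (covol_exponential), and the total
    density is bounded by a double geometric series that the choice of c
    makes small (BW_gsi).  The doubling is proved on Borel sets V whose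
    translates by Gam m are disjoint: if t is in Gam m but not in Gam m.+1,
    the union of V and t + V has disjoint translates by Gam m.+1, while the
    measure of a set with disjoint translates never exceeds that of a
    fundamental domain (packing_le_tiling).

    The functions e j are produced by the Gram-Schmidt process from indicators
    of the intersections of F with finitely many basic open sets of finite
    measure.  These are countably many, and their translates by Gam 0 form a
    system stable under intersection that generates the Borel sets; the
    pi-lambda theorem then shows that they span a dense subspace
    (closed_subspace_dense, translates_gs_total).  Everything takes place in
    the real L^2 space; a real orthonormal basis is also a basis of the
    complex one (orthonormal_basis_complexify). *)

(** * Closed subspaces of L^2 *)

Section SquareIntegral.
Context d (T : measurableType d) (R : realType).
Variable mu : {measure set T -> \bar R}.
Implicit Types f g : T -> R.

Definition sqint f : \bar R := (\int[mu]_x ((f x) ^+ 2)%:E)%E.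

Lemma sqint_ge0 f : (0 <= sqint f)%E.
Proof. by apply: integral_ge0 => x _; rewrite lee_fin sqr_ge0. Qed.

Lemma measurable_sq f : measurable_fun setT f ->
  measurable_fun setT ((fun x => ((f x) ^+ 2)%:E) : T -> \bar R).
Proof. by move=> mf; apply/measurable_EFinP; exact: measurable_funX. Qed.

Lemma le_sqint f g : measurable_fun setT f -> measurable_fun setT g ->
  (forall x, `|f x| <= `|g x|) -> (sqint f <= sqint g)%E.
Proof.
move=> mf mg fg; apply: ge0_le_integral => //.
- by move=> x _; rewrite lee_fin sqr_ge0.
- exact: measurable_sq.
- exact: measurable_sq.
- move=> x _; rewrite lee_fin -(real_normK (num_real (f x))).
  by rewrite -(real_normK (num_real (g x))) ler_sqr ?nnegrE.
Qed.

Lemma sqintZ a f : measurable_fun setT f ->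
  sqint (fun x => a * f x) = ((a ^+ 2)%:E * sqint f)%E.
Proof.
move=> mf; rewrite /sqint -ge0_integralZl//.
- by apply: eq_integral => x _; rewrite exprMn EFinM.
- exact: measurable_sq.
- by move=> x _; rewrite lee_fin sqr_ge0.
- by rewrite lee_fin sqr_ge0.
Qed.

(** Integrates (a + b)^2 <= 2 a^2 + 2 b^2.  It plays the part of the triangle
    inequality, so that distances can be measured by their squares. *)
Lemma sqintD f g : measurable_fun setT f -> measurable_fun setT g ->
  (sqint (fun x => f x + g x)%R <= 2%:E * sqint f + 2%:E * sqint g)%E.
Proof.
move=> mf mg.
have mf2 := measurable_sq mf; have mg2 := measurable_sq mg.
rewrite /sqint -!ge0_integralZl//; try by move=> x _; rewrite lee_fin sqr_ge0.
rewrite -ge0_integralD//.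
- apply: ge0_le_integral => //.
  + by move=> x _; rewrite lee_fin sqr_ge0.
  + by apply: measurable_sq; exact: measurable_funD.
  + by apply: emeasurable_funD; apply: measurable_funeM.
  + move=> x _; rewrite -!EFinM -EFinD lee_fin.
    have := sqr_ge0 (f x - g x); nra.
- by move=> x _; apply: mule_ge0 => //; rewrite lee_fin sqr_ge0.
- exact: measurable_funeM.
- by move=> x _; apply: mule_ge0 => //; rewrite lee_fin sqr_ge0.
- exact: measurable_funeM.
Qed.

(** Closedness is measured by the squared L^2 distance, and the members are
    functions, not classes: a closed subspace contains every measurable
    function that agrees almost everywhere with one of its members. *)
Record closed_subspace (C : set (T -> R)) : Prop := ClosedSubspace {
  closed_subspaceM : forall f, C f -> measurable_fun setT f;
  closed_subspace0 : C (fun=> 0);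
  closed_subspaceL : forall a f g, C f -> C g -> C (fun x => a * f x + g x);
  closed_subspace_lim : forall f, measurable_fun setT f ->
    (forall eps, 0 < eps -> exists2 g, C g &
       (sqint (fun x => f x - g x)%R < eps%:E)%E) -> C f }.

Section ClosedSubspaceTheory.
Variable C : set (T -> R).
Hypothesis hC : closed_subspace C.

Lemma closed_subspaceZ a f : C f -> C (fun x => a * f x).
Proof.
move=> Cf; have := closed_subspaceL hC a Cf (closed_subspace0 hC).
by under eq_fun do rewrite addr0.
Qed.

Lemma closed_subspaceD f g : C f -> C g -> C (fun x => f x + g x).
Proof.
move=> Cf Cg; have := closed_subspaceL hC 1 Cf Cg.
by under eq_fun do rewrite mul1r.
Qed.

Lemma closed_subspaceB f g : C f -> C g -> C (fun x => f x - g x).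
Proof.
move=> Cf Cg; have := closed_subspaceL hC (-1) Cg Cf.
by under eq_fun do rewrite mulN1r addrC.
Qed.

Lemma closed_subspace_sum (I : Type) (r : seq I) (F : I -> T -> R) :
  (forall i, C (F i)) -> C (fun x => \sum_(i <- r) F i x).
Proof.
move=> CF; elim: r => [|i r ih].
  by under eq_fun do rewrite big_nil; exact: closed_subspace0.
by under eq_fun do rewrite big_cons; exact: closed_subspaceD.
Qed.

(** Since |f - F n|^2 <= 4 h^2 is integrable, dominated convergence turns
    pointwise convergence into L^2 convergence. *)
Lemma closed_subspace_dominated (F : nat -> T -> R) (f h : T -> R) :
  (forall n, C (F n)) -> measurable_fun setT f -> measurable_fun setT h ->
  (sqint h < +oo)%E -> (forall n x, `|F n x| <= h x) ->
  (forall x, F n x @[n --> \oo] --> f x) -> C f.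
Proof.
move=> CF mf mh h2 Fh Ff; apply: (closed_subspace_lim hC mf) => eps eps0.
have fh x : `|f x| <= h x.
  have /(@cvg_norm _ R^o) Nf := Ff x.
  by apply: (cvgr_to_le Nf); exact: nearW.
have mF n : measurable_fun setT (F n) by exact: (closed_subspaceM hC).
pose G n x := ((f x - F n x) ^+ 2)%:E.
have [] := @dominated_convergence _ _ _ mu setT measurableT G (cst 0%E)
   (fun x => 4%:E * ((h x) ^+ 2)%:E)%E.
- by move=> n; apply: measurable_sq; exact: measurable_funB.
- exact: measurable_cst.
- apply: aeW => x _; apply/cvg_EFin; first exact: nearW.
  have -> : (0 : R) = (f x - f x) * (f x - f x) by rewrite subrr mulr0.
  rewrite /comp /G /=; under eq_fun do rewrite expr2.
  by apply: cvgM; (apply: cvgB; [exact: cvg_cst|exact: Ff]).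
- apply: integrableZl => //; apply/integrableP; split; first exact: measurable_sq.
  by under eq_integral => x _ do rewrite gee0_abs ?lee_fin ?sqr_ge0//.
- apply: aeW => x n _; rewrite /G gee0_abs ?lee_fin ?sqr_ge0//.
  have := fh x; have := Fh n x; rewrite !ler_norml => /andP[? ?] /andP[? ?].
  nra.
move=> _ _; rewrite integral0 => Gcvg.
have /Gcvg [N _ /(_ N (leqnn N)) /= GN] :
    nbhs (0%E : \bar R) [set y | (y < eps%:E)%E].
  by apply: open_nbhs_nbhs; split; [exact: open_ereal_lt_ereal|rewrite /= lte_fin].
by exists (F N).
Qed.


Lemma sqint_indic (A : set T) : measurable A -> sqint (\1_A) = mu A.
Proof.
move=> mA; rewrite -[in RHS](setIT A) -(integral_indic _ measurableT mA).
by apply: eq_integral => x _; rewrite indicE; case: (x \in A); rewrite ?expr1n ?expr0n.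
Qed.

Lemma closed_subspace_indicU (A B : set T) : A `&` B = set0 ->
  C \1_A -> C \1_B -> C \1_(A `|` B).
Proof.
move=> AB CA CB; have := closed_subspaceD CA CB.
rewrite (_ : (fun x => _) = \1_(A `|` B))//; apply/funext => x /=.
rewrite !indicE in_setU; have : ~ ((x \in A) && (x \in B)).
  by rewrite -in_setI AB in_set0.
by case: (x \in A); case: (x \in B) => //=; rewrite ?addr0 ?add0r.
Qed.

Lemma closed_subspace_indic_bigcup (A : nat -> set T) (B : set T) :
  (forall n, C \1_(A n)) -> (forall n, measurable (A n)) ->
  nondecreasing_seq A -> measurable B -> (mu B < +oo)%E ->
  (forall n, A n `<=` B) -> C \1_(\bigcup_n A n).
Proof.
move=> CA mA ndA mB Boo AB.
apply: (@closed_subspace_dominated (fun n => \1_(A n)) _ (\1_B)) => //.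
- by apply: measurable_indic; exact: bigcupT_measurable.
- by rewrite sqint_indic.
- move=> n x; rewrite !indicE ger0_norm// ler_nat.
  by case: (boolP (x \in A n)) => // /set_mem /AB /mem_set ->.
- move=> x; case: (boolP (x \in \bigcup_n A n)) => xA; last first.
    apply: cvg_near_cst; apply: nearW => n; rewrite !indicE (negbTE xA).
    rewrite memNset// => xn; move/negP: xA; apply; apply/mem_set.
    by exists n.
  have /set_mem[N _ xN] := xA.
  apply: cvg_near_cst; exists N => // n /= Nn; rewrite !indicE xA mem_set//.
  by have /subsetPset := ndA _ _ Nn; exact.
Qed.

Section Dense.
Variables (G : set (set T)) (D : nat -> set T).
Hypotheses (genG : @measurable _ T = <<s G >>) (GI : setI_closed G)
  (Goo : forall A, G A -> (mu A < +oo)%E) (GD : forall n, G (D n))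
  (DT : \bigcup_n D n = setT) (CG : forall A, G A -> C \1_A).

Let mG A : G A -> measurable A.
Proof. by rewrite genG => GA; exact: sub_gen_smallest. Qed.

Let mD n : measurable (D n). Proof. exact: mG. Qed.

(** Dynkin's pi-lambda argument, localized in the set D n of finite measure:
    there, complements amount to differences of indicators, and increasing
    unions to dominated limits. *)
Lemma closed_subspace_indicI n A : measurable A -> C \1_(A `&` D n).
Proof.
rewrite [in X in X -> _]genG; move: A.
apply: (@dynkin_induction _ T G (fun A => C \1_(A `&` D n))) => //.
- by rewrite setTI; exact: CG.
- by move=> A GA; apply: CG; exact: GI.
- move=> A mA CA; have := closed_subspaceB (CG (GD n)) CA.
  rewrite (_ : (fun x => _) = \1_(~` A `&` D n))//; apply/funext => x /=.
  rewrite !indicE !in_setI in_setC.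
  by case: (x \in A); case: (x \in D n); rewrite /= ?subr0 ?subrr.
- move=> F mF tF CF; rewrite setI_bigcupl.
  rewrite (_ : \bigcup_k _ =
      \bigcup_k (\big[setU/set0]_(i < k.+1) F i `&` D n)); last first.
    by rewrite -!setI_bigcupl bigcup_bigsetU_bigcup.
  have mU k : measurable (\big[setU/set0]_(i < k) F i `&` D n).
    by apply: measurableI => //; exact: bigsetU_measurable.
  have CU k : C \1_(\big[setU/set0]_(i < k) F i `&` D n).
    elim: k => [|k ih].
      by rewrite big_ord0 set0I indic0; exact: closed_subspace0.
    rewrite big_ord_recr/= setIUl; apply: closed_subspace_indicU => //.
    rewrite setIACA setIid -subset0 => x [[]].
    rewrite -bigcup_mkord => -[i /= ik Fi] Fk _.
    move/trivIsetP : (tF) => /(_ i k I I); rewrite (ltn_eqF ik) => /(_ isT).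
    by rewrite -subset0 => /(_ x); exact.
  apply: (@closed_subspace_indic_bigcup _ (D n)) => //.
  + move=> i j ij; apply/subsetPset; apply: setSI.
    by apply: (@subset_bigsetU _ F i.+1 j.+1).
  + exact: Goo.
Qed.

Let E n := \big[setU/set0]_(i < n) D i.

Let mE n : measurable (E n).
Proof. exact: bigsetU_measurable. Qed.

Lemma closed_subspace_indicE n A : measurable A -> C \1_(A `&` E n).
Proof.
move=> mA; elim: n => [|n ih].
  by rewrite /E big_ord0 setI0 indic0; exact: closed_subspace0.
rewrite /E big_ord_recr/= -/(E n).
rewrite (_ : _ `&` _ = (A `&` E n) `|` ((A `\` E n) `&` D n)); last first.
  apply/seteqP; split => [x [Ax [En|Dn]]|x [[Ax En]|[[Ax _] Dn]]].
  - by left.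
  - by have [xE|xE] := pselect (E n x); [left|right].
  - by split => //; left.
  - by split => //; right.
apply: closed_subspace_indicU => //.
  by rewrite -subset0 => x [[_ ?] [[_ ?]]].
by apply: closed_subspace_indicI; exact: measurableD.
Qed.

Import HBNNSimple.

(** The approximants are simple functions below f, cut off to the sets E n so
    that their level sets have finite measure; they are dominated by f. *)
Lemma closed_subspace_nneg f : measurable_fun setT f -> (sqint f < +oo)%E ->
  (forall x, 0 <= f x) -> C f.
Proof.
move=> mf foo f0.
have mEf : measurable_fun setT ((EFin \o f) : T -> \bar R) by exact/measurable_EFinP.
pose s := nnsfun_approx measurableT mEf.
have s_le n x : s n x <= f x.
  rewrite -lee_fin /s nnsfun_approxE.
  by apply: le_approx => // y _; rewrite /= lee_fin.
have s_cvg x : s n x @[n --> \oo] --> f x.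
  have := cvg_nnsfun_approx measurableT mEf (fun y _ => f0 y) (x := x) I.
  exact: fine_cvg.
apply: (@closed_subspace_dominated (fun n x => s n x * \1_(E n) x) f f) => //.
- move=> n; rewrite (_ : (fun x => _) = fun x =>
    \sum_(y <- finmap.enum_fset (fset_set (range (s n))))
    y * \1_(s n @^-1` [set y] `&` E n) x).
    apply: closed_subspace_sum => y; apply: closed_subspaceZ.
    by apply: closed_subspace_indicE; exact: measurable_funPTI.
  apply/funext => x; rewrite {1}fimfunE fsbig_finite//= mulr_suml.
  by apply: eq_bigr => y _; rewrite indicI mulrA.
- move=> n x; rewrite normrM !ger0_norm// -[leRHS]mulr1.
  apply: ler_pM => //.
- move=> x; rewrite -[X in _ --> X]mulr1; apply: cvgM => //.
  apply: cvg_near_cst.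
  have [N _ DN] : (\bigcup_n D n) x by rewrite DT.
  exists N.+1 => // n /= Nn; rewrite indicE mem_set// /E -bigcup_mkord.
  by exists N.
Qed.

(** f is half the difference of |f| + f and |f| - f, which are nonnegative. *)
Lemma closed_subspace_dense f : measurable_fun setT f -> (sqint f < +oo)%E ->
  C f.
Proof.
move=> mf foo.
have mNf : measurable_fun setT (fun x => `|f x|) by exact: measurableT_comp.
have h c : `|c| <= 1 -> C (fun x => `|f x| + c * f x).
  move=> c1; apply: closed_subspace_nneg.
  - by apply: measurable_funD => //; exact: measurable_funM.
  - apply: (@le_lt_trans _ _ (sqint (fun x => 2 * f x))).
      apply: le_sqint => //; first by apply: measurable_funD => //; exact: measurable_funM.
        exact: measurable_funM.
      move=> x; rewrite normrM (ger0_norm (_ : 0 <= 2))//.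
      apply: (le_trans (ler_normD _ _)); rewrite normr_id normrM.
      have := ler_wpM2r (normr_ge0 (f x)) c1; lra.
    by rewrite sqintZ// lte_mul_pinfty.
  - move=> x; rewrite -lerBlDr sub0r.
    apply: (le_trans (ler_norm _)); rewrite normrN normrM.
    by rewrite -[leRHS]mul1r; apply: ler_wpM2r.
have h1 : `|1 : R| <= 1 by rewrite normr1.
have h2 : `|-1 : R| <= 1 by rewrite normrN1.
have := closed_subspaceZ (2^-1) (closed_subspaceB (h _ h1) (h _ h2)).
rewrite (_ : (fun x => _) = f)//; by apply/funext => x /=; field.
Qed.

End Dense.
End ClosedSubspaceTheory.
End SquareIntegral.

(** * Inner products and the Gram-Schmidt process *)

Section InnerProduct.
Context d (T : measurableType d) (R : realType).
Variable mu : {measure set T -> \bar R}.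
Implicit Types f g h : T -> R.

Definition square_integrable f : Prop :=
  measurable_fun setT f /\ (sqint mu f < +oo)%E.

Definition dot f g : R := \int[mu]_x (f x * g x).

Lemma dotC f g : dot f g = dot g f.
Proof. by apply: eq_Rintegral => x _; rewrite mulrC. Qed.

Lemma integrable_sq f : square_integrable f ->
  mu.-integrable setT ((EFin \o (fun x => f x ^+ 2)) : T -> \bar R).
Proof.
move=> [mf foo]; apply/integrableP; split; first exact: measurable_sq.
by under eq_integral => x _ do rewrite /= ger0_norm ?sqr_ge0//.
Qed.

Lemma integrable_mul f g : square_integrable f -> square_integrable g ->
  mu.-integrable setT ((EFin \o (fun x => f x * g x)) : T -> \bar R).
Proof.
move=> sf sg.
have ifg := integrableD measurableT (integrable_sq sf) (integrable_sq sg).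
apply: (le_integrable _ _ _ ifg) => //.
  by apply/measurable_EFinP; apply: measurable_funM; [case: sf|case: sg].
move=> x _; rewrite /= lee_fin normrM.
rewrite [leRHS]ger0_norm ?addr_ge0 ?sqr_ge0//.
rewrite -(real_normK (num_real (f x))) -(real_normK (num_real (g x))).
have := sqr_ge0 (`|f x| - `|g x|); have := normr_ge0 (f x); have := normr_ge0 (g x).
nra.
Qed.

Lemma square_integrable0 : square_integrable (fun=> 0).
Proof.
split; first exact: measurable_cst.
rewrite /sqint; under eq_integral do rewrite expr0n/=.
by rewrite integral0.
Qed.

Lemma square_integrableL a f g : square_integrable f -> square_integrable g ->
  square_integrable (fun x => a * f x + g x).
Proof.
move=> [mf foo] [mg goo].
have maf : measurable_fun setT (fun x => a * f x) by exact: measurable_funM.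
split; first exact: measurable_funD.
apply: (le_lt_trans (sqintD _ _ _)) => //.
rewrite lte_add_pinfty// ?sqintZ// lte_mul_pinfty//.
by rewrite lte_mul_pinfty// lee_fin sqr_ge0.
Qed.

Lemma square_integrableZ a f : square_integrable f ->
  square_integrable (fun x => a * f x).
Proof.
move=> sf; have := square_integrableL a sf square_integrable0.
by under eq_fun do rewrite addr0.
Qed.

Lemma square_integrable_sum (I : eqType) (r : seq I) (c : I -> R)
    (e : I -> T -> R) f : square_integrable f ->
  {in r, forall i, square_integrable (e i)} ->
  square_integrable (fun x => f x - \sum_(i <- r) c i * e i x).
Proof.
move=> sf; elim: r => [|i r ih] se.
  by under eq_fun do rewrite big_nil subr0.
have := square_integrableL (- c i) (se i (mem_head _ _)) (ih _).
under [X in _ -> _ X]eq_fun do rewrite big_cons opprD addrCA -mulNr.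
by apply=> j jr; apply: se; rewrite inE jr orbT.
Qed.

Lemma dotL a f g h : square_integrable f -> square_integrable g ->
  square_integrable h -> dot (fun x => a * f x + g x) h = a * dot f h + dot g h.
Proof.
move=> sf sg sh; rewrite /dot -RintegralZl//; last exact: integrable_mul.
rewrite -RintegralD//; last first.
- exact: integrable_mul.
- have := integrable_mul (square_integrableZ a sf) sh.
  by under eq_fun do rewrite -mulrA.
by apply: eq_Rintegral => x _; rewrite mulrDl mulrA.
Qed.

Lemma dot0l h : dot (fun=> 0) h = 0.
Proof.
rewrite /dot /Rintegral; under eq_integral do rewrite mul0r.
by rewrite integral0.
Qed.

Lemma dotZ a f h : square_integrable f -> square_integrable h ->
  dot (fun x => a * f x) h = a * dot f h.
Proof.
move=> sf sh; have := dotL a sf square_integrable0 sh.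
by under eq_fun do rewrite addr0; rewrite dot0l addr0.
Qed.

Lemma dot_sum (I : eqType) (r : seq I) (c : I -> R) (e : I -> T -> R) f h :
  square_integrable f -> (forall i, square_integrable (e i)) ->
  square_integrable h ->
  dot (fun x => f x - \sum_(i <- r) c i * e i x) h =
  dot f h - \sum_(i <- r) c i * dot (e i) h.
Proof.
move=> sf se sh; elim: r => [|i r ih].
  by under eq_fun do rewrite big_nil subr0; rewrite big_nil subr0.
under eq_fun do rewrite big_cons opprD addrCA -mulNr.
by rewrite dotL//; [rewrite ih big_cons opprD mulNr addrCA | exact: square_integrable_sum].
Qed.

Lemma dotE f : square_integrable f -> (dot f f)%:E = sqint mu f.
Proof.
move=> [mf foo]; rewrite /dot /Rintegral /sqint fineK//.
by rewrite ge0_fin_numE// integral_ge0// => x _; rewrite lee_fin -expr2 sqr_ge0.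
Qed.

Lemma dot_ge0 f : 0 <= dot f f.
Proof. by apply: Rintegral_ge0 => x _; rewrite -expr2 sqr_ge0. Qed.

Section GramSchmidt.
Variable u : nat -> T -> R.
Hypothesis su : forall n, square_integrable (u n).

Definition residual f (s : seq (T -> R)) : T -> R :=
  fun x => f x - \sum_(g <- s) dot f g * g x.

(** A vanishing residual is replaced with zero, so that the output sequence is
    indexed by nat even though some vectors may have to be discarded. *)
Definition normalize f : T -> R :=
  if dot f f == 0 then fun=> 0 else fun x => (Num.sqrt (dot f f))^-1 * f x.

Fixpoint gs_prefix n : seq (T -> R) :=
  if n is m.+1
  then rcons (gs_prefix m) (normalize (residual (u m) (gs_prefix m)))
  else [::].

Definition gs n := normalize (residual (u n) (gs_prefix n)).

(* The n-th residual, as a sum over indices instead of a list of functions. *)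
Let r n x := u n x - \sum_(k <- iota 0 n) dot (u n) (gs k) * gs k x.

Lemma gsE n : gs n = normalize (r n).
Proof.
have pE m : gs_prefix m = [seq gs k | k <- iota 0 m].
  elim: m => [//|m ih]; by rewrite -[in RHS]addn1 iotaD map_cat -ih add0n cats1.
rewrite {1}/gs /residual pE; congr normalize.
by apply/funext => x; rewrite big_map.
Qed.

Lemma square_integrable_normalize f :
  square_integrable f -> square_integrable (normalize f).
Proof.
rewrite /normalize => sf; case: ifP => _; first exact: square_integrable0.
exact: square_integrableZ.
Qed.

Lemma square_integrable_gs n : square_integrable (gs n).
Proof.
elim/ltn_ind: n => n ih; rewrite gsE; apply: square_integrable_normalize.
apply: square_integrable_sum => // k; rewrite mem_iota => /andP[_].
exact: ih.
Qed.

Let sr n : square_integrable (r n).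
Proof. by apply: square_integrable_sum => // k _; exact: square_integrable_gs. Qed.

Lemma gs_eq0_or_unit n : gs n = (fun=> 0) \/ dot (gs n) (gs n) = 1.
Proof.
rewrite gsE /normalize; case: ifPn => [_|r0]; [by left|right].
rewrite dotZ//; last exact: square_integrableZ.
rewrite dotC dotZ// mulrA -expr2 exprVn sqr_sqrtr ?dot_ge0//.
by rewrite mulVf.
Qed.

Lemma dot_gs_lt m n : (m < n)%N -> dot (gs n) (gs m) = 0.
Proof.
elim/ltn_ind: n m => n ih m mn.
suff rm : dot (r n) (gs m) = 0.
  rewrite gsE {1}/normalize; case: ifP => _; first by rewrite dot0l.
  by rewrite dotZ// ?rm ?mulr0//; exact: square_integrable_gs.
rewrite dot_sum//; try by move=> *; exact: square_integrable_gs.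
rewrite (bigD1_seq m) ?iota_uniq ?mem_iota//= big_seq_cond big1 ?addr0.
  have [->|->] := gs_eq0_or_unit m; last by rewrite mulr1 subrr.
  by rewrite dotC !dot0l mulr0 subrr.
move=> k /andP[]; rewrite mem_iota /= add0n => kn km.
have [km'|mk|/eqP] := ltngtP k m; last by rewrite (negbTE km).
  by rewrite [dot (gs k) _]dotC (ih m mn k km') mulr0.
by rewrite (ih k kn m mk) mulr0.
Qed.

Lemma dot_gs m n : m != n -> dot (gs m) (gs n) = 0.
Proof.
by rewrite neq_ltn => /orP[mn|mn]; [rewrite dotC|]; exact: dot_gs_lt.
Qed.

Lemma gs_vanish x : (forall n, u n x = 0) -> forall n, gs n x = 0.
Proof.
move=> u0; elim/ltn_ind=> n ih; rewrite gsE /normalize; case: ifP => // _.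
rewrite /r u0 big_seq big1 ?subr0 ?mulr0// => k.
by rewrite mem_iota => /andP[_ kn]; rewrite ih ?mulr0.
Qed.

(** u n is its residual plus a combination of earlier output vectors.  The
    residual is a multiple of the n-th output vector, unless its norm is zero:
    then u n is at distance zero from that combination. *)
Lemma gs_generates (C : set (T -> R)) : closed_subspace mu C ->
  (forall n, C (gs n)) -> forall n, C (u n).
Proof.
move=> hC Cgs n.
have CS : C (fun x => \sum_(k <- iota 0 n) dot (u n) (gs k) * gs k x).
  by apply: (closed_subspace_sum hC) => k; exact: (closed_subspaceZ hC).
have [r0|r0] := eqVneq (dot (r n) (r n)) 0.
  apply: (closed_subspace_lim hC (su n).1) => eps eps0.
  exists (fun x => \sum_(k <- iota 0 n) dot (u n) (gs k) * gs k x) => //.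
  by rewrite -(dotE (sr n)) r0 lte_fin.
have := closed_subspaceL hC (Num.sqrt (dot (r n) (r n))) (Cgs n) CS.
rewrite (_ : (fun x => _) = u n)//; apply/funext => x.
rewrite gsE /normalize (negbTE r0) mulrA divff ?mul1r ?subrK//.
by rewrite gt_eqF// sqrtr_gt0 lt0r r0 dot_ge0.
Qed.

End GramSchmidt.
End InnerProduct.

(** * Translations of a topological group *)

Section Translation.
Variables (G : topologicalZmodType).
Implicit Types (a x y : G) (U : set G).

Notation borel := (@measurable _ (borelType G)).

Lemma open_borel U : open U -> borel U.
Proof. by move=> oU; exact: sub_sigma_algebra. Qed.

Lemma continuous_subl a : continuous (fun x => x - a).
Proof.
move=> x; apply: (@continuous_comp _ _ _ (fun x => (x, a)) (fun z : G * G => z.1 - z.2)).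
  by apply: cvg_pair; [exact: cvg_id|exact: cvg_cst].
exact: sub_continuous.
Qed.

Lemma open_subl a U : open U -> open [set x | U (x - a)].
Proof. by move=> oU; apply: open_comp => // x _; exact: continuous_subl. Qed.

Lemma measurable_subl a :
  measurable_fun setT ((fun x => x - a) : borelType G -> borelType G).
Proof.
apply: (@measurability _ _ (borelType G) (borelType G) setT _ (@open G)) => //.
move=> _ [U oU <-]; rewrite setTI; apply: open_borel.
exact: open_subl.
Qed.

Lemma borel_subl a A : borel A -> borel [set x | A (x - a)].
Proof.
by move=> mA; rewrite -[X in borel X]setTI; exact: measurable_subl.
Qed.

Lemma translateE a (A : set G) : translate a A = [set x | A (x - a)].
Proof.
apply/seteqP; split => [_ [y Ay <-]|x /= Ax]; first by rewrite /= addrC addKr.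
by exists (x - a); rewrite // addrC subrK.
Qed.

Section Haar.
Context (R : realType) (mu : {measure set (borelType G) -> \bar R}).
Hypothesis haar_mu : haar_measure mu.

(** Translates are handled as preimages under subtraction, which makes their
    measurability immediate. *)
Lemma haar_subl a (A : set G) : borel A -> mu [set x | A (x - a)] = mu A.
Proof.
by move=> mA; rewrite -translateE; exact: (haar_translation haar_mu).
Qed.

Lemma sqint_translation a (f : borelType G -> R) : measurable_fun setT f ->
  sqint mu (fun x => f (x - a)) = sqint mu f.
Proof.
move=> mf; rewrite /sqint.
have := @ge0_integral_pushforward _ _ _ _ R _ (measurable_subl a) mu setT
  (fun x => ((f x) ^+ 2)%:E) measurableT (measurable_sq mf).
rewrite preimage_setT => <-; last by move=> x _; rewrite lee_fin sqr_ge0.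
by apply: eq_measure_integral; [exact: measurable_subl|move=> ? A mA _; exact: haar_subl].
Qed.

Lemma measurable_translation a (f : borelType G -> R) : measurable_fun setT f ->
  measurable_fun setT (fun x : borelType G => f (x - a)).
Proof. by move=> mf; apply: measurableT_comp => //; exact: measurable_subl. Qed.

Lemma square_integrable_translation a (f : borelType G -> R) :
  square_integrable mu f -> square_integrable mu (fun x => f (x - a)).
Proof.
by move=> [mf foo]; split; [exact: measurable_translation|rewrite sqint_translation].
Qed.

Lemma dot_translation a (f g : borelType G -> R) :
  square_integrable mu f -> square_integrable mu g ->
  dot mu (fun x => f (x - a)) (fun x => g (x - a)) = dot mu f g.
Proof.
move=> sf sg; rewrite /dot /Rintegral; congr fine.
have mfg := measurable_int _ (integrable_mul sf sg).
have ifg := integrable_mul (square_integrable_translation a sf)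
  (square_integrable_translation a sg).
have := @integral_pushforward _ _ _ _ R _ (measurable_subl a) mu setT
  (fun x => (f x * g x)%:E) mfg.
rewrite preimage_setT => <- //.
by apply: eq_measure_integral; [exact: measurable_subl|move=> ? A mA _; exact: haar_subl].
Qed.

End Haar.
End Translation.

(** * Discrete subgroups, transversals and covolumes *)

Section DiscreteSubgroups.
Variables (G : topologicalZmodType).
Hypothesis scG : @second_countable G.
Implicit Types (a x y : G) (U : set G) (Gam : zmodClosed G).

Notation borel := (@measurable _ (borelType G)).

(** Subtraction is continuous at (0, 0), so two points of a small enough
    neighbourhood of 0 have their difference in a neighbourhood of 0 that
    meets Gam in 0 only. *)
Lemma discrete_separated Gam : discrete_subgroup Gam ->
  exists U, [/\ open U, U 0 &
    forall x y, U x -> U y -> x - y \in Gam -> x = y].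
Proof.
move=> /(_ 0 (rpred0 _)) [W W0 WG].
have := @sub_continuous G (0, 0); rewrite /continuous_at /= subrr => /(_ _ W0).
case=> -[A B] /= [A0 B0] ABW.
exists (A `&` B)^°; split.
- exact: open_interior.
- by apply: filterI.
- move=> x y /interior_subset[Ax _] /interior_subset[_ By] xyG.
  have : (W `&` [set` Gam]) (x - y) by split => //; exact: (ABW (x, y)).
  by rewrite WG => /eqP; rewrite subr_eq0 => /eqP.
Qed.

Lemma countable_base : exists B : nat -> set G,
  (forall n, open (B n)) /\
  (forall O x, open O -> O x -> exists n, B n x /\ B n `<=` O).
Proof.
have [B cB [oB bB]] := scG.
have [B0|[f]] : B = set0 \/ $|{surjfun [set: nat] >-> B}| by exact/pfcard_geP.
  have := bB 0 setT filterT; rewrite /= => -[A [+ _]].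
  by rewrite B0.
exists f; split; first by move=> n; apply: oB; exact: funS.
move=> O x oO Ox; have [A [BA Ax] AO] := bB x O (open_nbhs_nbhs (conj oO Ox)).
by have [n _ fn] := @surj _ _ _ _ f A BA; exists n; rewrite fn.
Qed.

(** Lindelof argument: choose one translate of U around each basic open set
    that is included in some translate of U. *)
Lemma translates_cover U : open U -> U 0 ->
  exists g : nat -> G, forall x, exists n, U (x - g n).
Proof.
move=> oU U0; have [B [oB bB]] := countable_base.
have /choice[g gP] : forall n, exists y,
    (exists z, B n `<=` [set x | U (x - z)]) -> B n `<=` [set x | U (x - y)].
  move=> n; have [[z Bz]|nB] := pselect (exists z, B n `<=` [set x | U (x - z)]).
    by exists z.
  by exists 0.
exists g => x.
have [|n [Bx BU]] := bB [set y | U (y - x)] x (open_subl x oU).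
  by rewrite /= subrr.
by exists n; apply: (gP n) => //; exists x.
Qed.

(** Countably many translates of a separated set cover G, and each of them
    contains at most one element of Gam. *)
Lemma discrete_countable Gam : discrete_subgroup Gam ->
  exists g : nat -> G, (forall n, g n \in Gam) /\
    (forall x, x \in Gam -> exists n, g n = x).
Proof.
move=> /discrete_separated[U [oU U0 UG]].
have [y yP] := translates_cover oU U0.
have /choice[g gP] : forall n, exists a, a \in Gam /\
    (forall x, x \in Gam -> U (x - y n) -> a = x).
  move=> n; have [[z [zG Uz]]|nz] := pselect (exists z, z \in Gam /\ U (z - y n)).
    exists z; split => // x xG Ux; apply: (addIr (- y n)); apply: UG => //.
    by rewrite opprB addrA subrK rpredB.
  exists 0; split; first exact: rpred0.
  by move=> x xG Ux; exfalso; apply: nz; exists x.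
exists g; split=> [n|x xG]; first by have [] := gP n.
by have [n Un] := yP x; exists n; have [_] := gP n; apply.
Qed.

Definition disjoint_translates Gam (V : set G) :=
  forall a x, a \in Gam -> V x -> V (x - a) -> a = 0.

Definition exact_transversal Gam (F : set G) :=
  [/\ borel F, forall x, exists2 a, a \in Gam & F (x - a) &
     disjoint_translates Gam F].

(** From each coset, keep the points that lie in the first separated translate
    y n + U to meet that coset: exactly one such point exists.  The set A n is
    the union of the cosets that meet y n + U. *)
Lemma exists_transversal Gam : discrete_subgroup Gam ->
  exists F, exact_transversal Gam F.
Proof.
move=> /discrete_separated[U [oU U0 UG]].
have [y yP] := translates_cover oU U0.
pose A n := [set x | exists2 a, a \in Gam & U (x - a - y n)].
have oA n : open (A n).
  rewrite (_ : A n = \bigcup_(a in [set` Gam]) [set x | U (x - (a + y n))]).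
    by apply: bigcup_open => a _; exact: open_subl.
  by apply/seteqP; split => [x [a aG Ux]|x [a aG Ux]];
    exists a; rewrite //= ?opprD ?addrA// -addrA -opprD.
have AG n x a : a \in Gam -> A n x -> A n (x - a).
  move=> aG [b bG Ub]; exists (b - a); first exact: rpredB.
  by rewrite opprB addrA subrK.
have AGV n x a : a \in Gam -> A n (x - a) -> A n x.
  by move=> aG /(AG n _ (- a)); rewrite rpredN opprK subrK; exact.
pose F := \bigcup_n ([set x | U (x - y n)] `\` \bigcup_(k in [set k | (k < n)%N]) A k).
have UA n x : U (x - y n) -> A n x.
  by move=> Ux; exists 0; rewrite ?rpred0// subr0.
exists F; split.
- apply: bigcupT_measurable => n; apply: measurableD.
    by apply: open_borel; exact: open_subl.
  by apply: open_borel; apply: bigcup_open => k _.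
- move=> x; have Px : exists n, `[< A n x >].
    by have [n Un] := yP x; exists n; apply/asboolP; exact: UA.
  have [n /asboolP[a aG Ua] nmin] := ex_minnP Px.
  exists a => //; exists n => //; split => //= -[k /= kn] Ak.
  suff /nmin : `[< A k x >] by rewrite leqNgt kn.
  by apply/asboolP; exact: AGV Ak.
- move=> a x aG [n _ [Un nA]] [m _ [Um mA]].
  have nm : n = m.
    have [nm|mn|//] := ltngtP n m; exfalso.
    + by apply: mA; exists n => //; apply: AG => //; exact: UA.
    + by apply: nA; exists m => //; apply: (AGV _ _ a) => //; exact: UA.
  rewrite -nm in Um; have : x - y n = x - a - y n.
    by apply: UG => //; rewrite opprB addrA subrK opprB addrCA subrr addr0.
  by move=> /addIr /eqP; rewrite -subr_eq0 opprB addrCA subrr addr0 => /eqP.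
Qed.

Section Covolume.
Context (R : realType) (mu : {measure set (borelType G) -> \bar R}).
Hypothesis haar_mu : haar_measure mu.

Lemma transversal_fundamental_domain Gam F : exact_transversal Gam F ->
  fundamental_domain mu Gam F.
Proof.
move=> [mF FT FI]; split => //.
- move=> x y xG yG xy; rewrite !translateE.
  rewrite (_ : _ `&` _ = set0); first exact: negligible_set0.
  rewrite -subset0 => z [/= Fx Fy].
  have yx : y - x = 0.
    apply: (FI _ (z - x)) => //; first exact: rpredB.
    by rewrite opprB addrA subrK.
  by move/eqP: xy; apply; apply/eqP; rewrite eq_sym -subr_eq0 yx.
- rewrite (_ : ~` _ = set0); first exact: negligible_set0.
  rewrite -subset0 => z; apply => /=.
  by have [a aG Fz] := FT z; exists a => //; rewrite translateE.
Qed.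

(** Countably many translates of U cover G, which is not negligible. *)
Lemma haar_open_gt0 U : open U -> U !=set0 -> (0 < mu U)%E.
Proof.
move=> oU [u Uu]; have [oV V0] : open [set x | U (x - - u)] /\ U (0 - - u).
  by split; [exact: open_subl|rewrite opprK add0r].
have [g gP] := translates_cover oV V0.
rewrite lt_neqAle measure_ge0 andbT; apply/eqP => mu0.
apply: (haar_neq0 haar_mu); apply/eqP; rewrite eq_le measure_ge0 andbT.
pose A n := [set x | U (x - (g n - u))].
have mA n : borel (A n) by apply: open_borel; exact: open_subl.
have -> : [set: borelType G] = \bigcup_n A n.
  apply/seteqP; split => // x _; have [n Un] := gP x; exists n => //.
  by move: Un; rewrite /A /= opprB addrA opprK addrAC.
apply: (le_trans (measure_sigma_subadditive mu (F := A) _ _ _)) => //.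
  exact: bigcupT_measurable.
rewrite eseries0// => n _ _; rewrite /A haar_subl// -?mu0//.
exact: open_borel.
Qed.

(** Cut V along the tiles g n + F and move each piece back into F.  As the
    translates of V are disjoint, the pieces remain disjoint in F.  The
    enumeration g may repeat elements of Gam, hence the sets seqDU. *)
Lemma packing_le_tiling Gam (V F : set G) : discrete_subgroup Gam ->
  borel V -> disjoint_translates Gam V ->
  fundamental_domain mu Gam F -> (mu V <= mu F)%E.
Proof.
move=> dG mV Vp [mF _ negF].
have [g [gG gsur]] := discrete_countable dG.
pose A n := V `&` [set x | F (x - g n)].
have mA n : borel (A n) by apply: measurableI => //; exact: borel_subl.
pose D := seqDU A.
have mD n : borel (D n).
  by apply: measurableD => //; exact: bigsetU_measurable.
have mUA : borel (\bigcup_n A n) by exact: bigcupT_measurable.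
have VA0 : mu (V `\` \bigcup_n A n) = 0%E.
  apply: (negligibleP _ _).1; first exact: measurableD.
  apply: negligibleS negF => x [Vx nA] [a aG]; rewrite translateE /= => Fx.
  by have [n gn] := gsur a aG; apply: nA; exists n => //; split => //=; rewrite gn.
have VD : (mu V <= mu (\bigcup_n D n))%E.
  rewrite -seqDU_bigcup_eq -[leRHS]adde0 -VA0.
  apply: (le_trans _ (measureU2 _ _ _)) => //; last exact: measurableD.
  apply: le_measure; rewrite ?inE//.
    by apply: measurableU => //; exact: measurableD.
  by move=> x Vx; have [|] := pselect ((\bigcup_n A n) x); [left|right].
apply: (le_trans VD); pose S n := [set x | D n (x - - g n)].
have mS n : borel (S n) by exact: borel_subl.
rewrite measure_semi_bigcup//; last 2 first.
- exact: trivIset_seqDU.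
- exact: bigcupT_measurable.
have -> : (\sum_(n <oo) mu (D n) = \sum_(n <oo) mu (S n))%E.
  by apply: eq_eseriesr => n _; rewrite /S haar_subl.
rewrite -measure_semi_bigcup//; last 2 first.
- apply/trivIsetP => i j _ _ ij; rewrite -subset0 => x [/= Di Dj].
  have gij : g i - g j = 0.
    apply: (Vp _ (x - - g i)); first exact: rpredB.
      by case: Di => [[]].
    rewrite !opprK opprB addrA addrAC addrK -[g j]opprK.
    by case: Dj => [[]].
  move/eqP : gij; rewrite subr_eq0 => /eqP gij; rewrite /S /= -gij in Dj.
  have /trivIsetP /(_ i j I I ij) := trivIset_seqDU A.
  by rewrite -subset0 => /(_ (x - - g i)); exact.
- exact: bigcupT_measurable.
apply: le_measure; rewrite ?inE//; first exact: bigcupT_measurable.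
by move=> x [n _ [[_ /=]]]; rewrite opprK addrK.
Qed.

Lemma le_covol Gam (V : set G) : discrete_subgroup Gam ->
  borel V -> disjoint_translates Gam V ->
  (mu V <= covol mu Gam)%E.
Proof.
move=> dG mV Vp; have [F /transversal_fundamental_domain FD] := exists_transversal dG.
have : [set mu F | F in [set F | fundamental_domain mu Gam F]] (covol mu Gam).
  by apply: xgetPex; exists (mu F); exists F.
by move=> [F' FD' <-]; exact: packing_le_tiling FD'.
Qed.

Section Chain.
Variable Gam : nat -> zmodClosed G.
Hypotheses (dGam : forall n, discrete_subgroup (Gam n))
  (decr : forall n, [set` Gam n.+1] `<` [set` Gam n]).

Lemma chain_sub m n : (m <= n)%N -> {subset Gam n <= Gam m}.
Proof.
move=> /subnK <-; elim: (n - m)%N => // k ih x xG; apply: ih.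
by have [+ _] := decr (k + m); exact.
Qed.

(** Given a set V with disjoint translates by Gam m, and t in Gam m but not in
    Gam m.+1, the union of V and t + V has twice the measure of V and disjoint
    translates by Gam m.+1. *)
Lemma covol_exponential : exists2 c : R, 0 < c &
  forall m, ((c * 2 ^+ m)%:E <= covol mu (Gam m))%E.
Proof.
have [U [oU U0 UG]] := discrete_separated (@dGam 0%N).
have [c c0 cU] : exists2 c : R, 0 < c & (c%:E <= mu U)%E.
  have : (0 < mu U)%E by apply: haar_open_gt0 => //; exists 0.
  case: (mu U) => [r r0|_|//]; first by exists r.
  by exists 1 => //; rewrite leey.
exists c => // m.
have [V [mV Vp cV]] : exists V : set G, [/\ borel V,
    disjoint_translates (Gam m) V &
    ((c * 2 ^+ m)%:E <= mu V)%E].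
  elim: m => [|m [V [mV Vp cV]]].
    exists U; split; [exact: open_borel| |by rewrite expr0 mulr1].
    move=> a x aG Ux Ua; have xa : x = x - a.
      by apply: UG => //; rewrite opprB addrCA subrr addr0.
    by apply/eqP; rewrite -oppr_eq0 -(inj_eq (addrI x)) addr0 -xa.
  have [sG /nonsubset[t [tG tnG]]] := decr m.
  have mtV : borel [set x | V (x - t)] by exact: borel_subl.
  have Vt0 : V `&` [set x | V (x - t)] = set0.
    rewrite -subset0 => x [Vx Vt]; apply: tnG => /=.
    by rewrite (Vp t x)// rpred0.
  exists (V `|` [set x | V (x - t)]); split.
  - exact: measurableU.
  - move=> a x aG' [Vx|Vx] [Va|Va]; have aG := sG _ aG'.
    + exact: (Vp a x).
    + exfalso; apply: tnG; rewrite /= -[t](addKr a) rpredD ?rpredN//.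
      by rewrite (Vp (a + t) x) ?rpred0 ?rpredD// opprD addrA.
    + exfalso; apply: tnG; rewrite /= -[t](subKr a) rpredB//.
      rewrite (Vp (a - t) (x - t)) ?rpred0 ?rpredB//.
      by rewrite opprB addrA subrK.
    + by apply: (Vp a (x - t)) => //; rewrite addrAC.
  - have -> : mu (V `|` [set x | V (x - t)]) = (mu V + mu V)%E.
      by rewrite -[X in (_ + X)%E](haar_subl haar_mu t mV); exact: measureU.
    rewrite exprSr mulrA mulr_natr mulr2n EFinD.
    exact: leeD.
by apply: (le_trans cV); exact: le_covol.
Qed.

(** Greedy partition of Gam 0 into cosets g n + Gam (n + c). *)
Section Cosets.
Variables (g : nat -> G) (c : nat).

(** It would be equivalent to test g n against the fresh earlier cosets only,
    since each coset that is not fresh is included in a fresh earlier one. *)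
Definition fresh_coset n : bool :=
  `[< forall k, (k < n)%N -> g n - g k \notin Gam (k + c) >].

(** The first coset that contains x is fresh: had an earlier coset contained
    g n, it would contain the whole coset of g n, and x in particular. *)
Lemma fresh_cosets_cover x : (exists n, g n = x) ->
  exists n a, [/\ fresh_coset n, a \in Gam (n + c) & x = a + g n].
Proof.
move=> [m gm].
have Px : exists n, x - g n \in Gam (n + c) by exists m; rewrite gm subrr rpred0.
have [n xn nmin] := ex_minnP Px.
exists n, (x - g n); split; rewrite ?subrK//.
apply/asboolP => k kn; apply/negP => gnk.
suff /nmin : x - g k \in Gam (k + c) by rewrite leqNgt kn.
rewrite -[x](subrK (g n)) -addrA rpredD//.
by apply: chain_sub xn; rewrite leq_add2r ltnW.
Qed.

Lemma fresh_cosets_disjoint m n a b : fresh_coset m -> fresh_coset n ->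
  a \in Gam (m + c) -> b \in Gam (n + c) -> a + g m = b + g n -> m = n.
Proof.
have H k l u v : (k < l)%N -> fresh_coset l ->
    u \in Gam (k + c) -> v \in Gam (l + c) -> u + g k = v + g l -> False.
  move=> kl /asboolP /(_ k kl) /negP fl uG vG uv; apply: fl.
  have -> : g l - g k = u - v by apply/eqP; rewrite subr_eq addrAC uv addrAC subrr add0r.
  by rewrite rpredB//; apply: chain_sub vG; rewrite leq_add2r ltnW.
move=> fm fn aG bG ab; have [mn|nm|//] := ltngtP m n; exfalso.
- exact: (H m n a b).
- exact: (H n m b a).
Qed.

End Cosets.
End Chain.

End Covolume.
End DiscreteSubgroups.

(** * Density of the translates of a countable family *)

Section Density.
Context (R : realType) (G : topologicalZmodType)
  (mu : {measure set (borelType G) -> \bar R}).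
Hypotheses (lcG : locally_compact [set: G])
  (scG : @second_countable G) (haar_mu : haar_measure mu).

Notation borel := (@measurable _ (borelType G)).

(** By local compactness, the basic open sets of finite measure already form a
    base; the other ones are replaced with the empty set. *)
Lemma finite_measure_base : exists B : nat -> set G,
  [/\ forall n, open (B n), forall n, (mu (B n) < +oo)%E &
  forall O x, open O -> O x -> exists n, B n x /\ B n `<=` O].
Proof.
have [B [oB bB]] := countable_base scG.
pose B' n := if (mu (B n) < +oo)%E then B n else set0.
exists B'; split.
- by move=> n; rewrite /B'; case: ifP => // _; exact: open0.
- by move=> n; rewrite /B'; case: ifPn => // _; rewrite measure0.
- move=> O x oO Ox.
  have [K Kx [cK clK]] := lcG (I : setT x).
  have {}Kx : nbhs x K by move: Kx; rewrite /within /=; apply: filterS => y /(_ I).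
  have [n [Bx BO]] := bB (O `&` K^°) x (openI oO (open_interior K)) (conj Ox Kx).
  have Bn : (mu (B n) < +oo)%E.
    apply: le_lt_trans (haar_compact haar_mu cK).
    apply: le_measure; rewrite ?inE.
    - exact: open_borel.
    - rewrite -[X in borel X]setCK; apply: measurableC; apply: open_borel.
      exact: closed_openC.
    - by move=> y /BO [_ /interior_subset].
  by exists n; rewrite /B' Bn; split => // y /BO[].
Qed.

Section ClosedTranslate.
Variable C : set (borelType G -> R).
Hypothesis hC : closed_subspace mu C.

Lemma closed_subspace_translate (a : G) : closed_subspace mu
  [set f : borelType G -> R | measurable_fun setT f /\ C (fun x => f (x - a))].
Proof.
split.
- by move=> f [].
- by split; [exact: measurable_cst|exact: (closed_subspace0 hC)].
- move=> c f g [mf Cf] [mg Cg]; split; last exact: (closed_subspaceL hC c Cf Cg).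
  by apply: measurable_funD => //; exact: measurable_funM.
- move=> f mf fC; split => //; apply: (closed_subspace_lim hC).
    exact: measurable_translation.
  move=> eps eps0; have [g [mg Cg] fg] := fC eps eps0.
  exists (fun x => g (x - a)) => //.
  rewrite (sqint_translation haar_mu a (f := fun x => f x - g x))//.
  exact: measurable_funB.
Qed.

End ClosedTranslate.

Section Cells.
Variables (Gam : zmodClosed G) (g : nat -> G) (F : set G) (B : nat -> set G).
Hypotheses (gG : forall n, g n \in Gam)
  (gsur : forall x, x \in Gam -> exists n, g n = x)
  (FT : exact_transversal Gam F)
  (oB : forall n, open (B n)) (Boo : forall n, (mu (B n) < +oo)%E)
  (bB : forall O x, open O -> O x -> exists n, B n x /\ B n `<=` O).

(** The base set of index p.1 keeps the cell of finite measure even when the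
    list p.2 is empty. *)
Definition cell (p : nat * seq nat) : set G :=
  F `&` (B p.1 `&` \bigcap_(j in [set` p.2]) B j).

Lemma cell_transversal p : cell p `<=` F. Proof. by move=> x []. Qed.

Lemma borel_cell p : borel (cell p).
Proof.
have [mF _ _] := FT.
apply: measurableI => //; apply: measurableI; first exact: open_borel.
rewrite -[X in borel X]setCK setC_bigcap; apply: measurableC.
by apply: bigcup_measurable => j _; apply: measurableC; exact: open_borel.
Qed.

Lemma cell_lty p : (mu (cell p) < +oo)%E.
Proof.
apply: le_lt_trans (Boo p.1).
apply: le_measure; rewrite ?inE; [exact: borel_cell|exact: open_borel|].
by move=> x [_ []].
Qed.

Definition translated_cells : set (set (borelType G)) :=
  [set A | A = set0 \/ exists2 a, a \in Gam & exists p, A = [set x | cell p (x - a)]].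

(** Translates by distinct elements of Gam are disjoint, being included in
    distinct tiles; in a common tile, intersecting two cells concatenates
    their indices. *)
Lemma translated_cells_setI : setI_closed translated_cells.
Proof.
move=> _ _ [->|[a aG [p ->]]] [->|[b bG [q ->]]]; rewrite ?set0I ?setI0; try by left.
have [ab|ab] := eqVneq a b; last first.
  left; rewrite -subset0 => x [/cell_transversal Fa /cell_transversal Fb].
  have [_ _ FI] := FT.
  have : b - a = 0.
    apply: (FI _ (x - a)) => //; first exact: rpredB.
    by rewrite opprB addrA subrK.
  by move/eqP; rewrite subr_eq0 eq_sym (negbTE ab).
right; exists a => //; exists (p.1, p.2 ++ q.1 :: q.2).
rewrite -ab; apply/seteqP; split => [x [[Fx [Bp Bps]] [_ [Bq Bqs]]]|x [Fx [Bp Bs]]].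
  split=> //; split => // j /=; rewrite mem_cat inE => /or3P[jp|/eqP->//|jq].
    exact: Bps.
  exact: Bqs.
split; split => //; split => //.
- by move=> j jp; apply: Bs; rewrite /= mem_cat jp.
- by apply: Bs; rewrite /= mem_cat mem_head orbT.
- by move=> j jq; apply: Bs; rewrite /= mem_cat inE jq !orbT.
Qed.

Lemma borel_translated_cells A : translated_cells A -> borel A.
Proof.
move=> [->|[a aG [p ->]]]; first exact: measurable0.
by apply: borel_subl; exact: borel_cell.
Qed.

Lemma translated_cells_lty A : translated_cells A -> (mu A < +oo)%E.
Proof.
move=> [->|[a aG [p ->]]]; first by rewrite measure0.
rewrite (haar_subl haar_mu a); [exact: cell_lty|exact: borel_cell].
Qed.

Definition basic_cell (n : nat) : set (borelType G) :=
  if @unpickle (nat * nat)%type n is Some (k, i)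
  then [set x | cell (i, [::]) (x - g k)] else set0.

Lemma translated_cells_basic n : translated_cells (basic_cell n).
Proof.
rewrite /basic_cell; case: unpickle => [[k i]|]; last by left.
by right; exists (g k) => //; exists (i, [::]).
Qed.

Lemma basic_cell_base (O : set G) x : open O -> O x ->
  exists n, basic_cell n x /\ basic_cell n `<=` O.
Proof.
move=> oO Ox; have [_ /(_ x)[a aG Fx] _] := FT.
have [k gk] := gsur aG; rewrite -gk in Fx.
have [||i [Bi BO]] := @bB [set y | O (y - - g k)] (x - g k).
- exact: open_subl.
- by rewrite /= opprK subrK.
exists (pickle (k, i)); rewrite /basic_cell pickleK; split.
  by split => //; split => // j; rewrite /= in_nil.
by move=> y [_ [/BO + _]]; rewrite /= opprK subrK.
Qed.

Lemma bigcup_basic_cell : \bigcup_n basic_cell n = setT.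
Proof.
apply/seteqP; split => // x _.
by have [n [xn _]] := basic_cell_base openT (I : setT x); exists n.
Qed.

(** An open set is the union of the basic cells that it contains. *)
Lemma translated_cells_generate : borel = <<s translated_cells >>.
Proof.
apply/seteqP; split.
- apply: smallest_sub; first exact: smallest_sigma_algebra.
  move=> O oO.
  have -> : O = \bigcup_n (if `[< basic_cell n `<=` O >] then basic_cell n else set0).
    apply/seteqP; split => [x Ox|x [n _]]; last by case: asboolP => // + xn; exact.
    have [n [xn nO]] := basic_cell_base oO Ox; exists n => //.
    by rewrite asboolT.
  have [_ _] := @smallest_sigma_algebra _ setT translated_cells; apply=> n.
  case: ifP => _; apply: sub_gen_smallest; last by left.
  exact: translated_cells_basic.
- apply: smallest_sub; last exact: borel_translated_cells.
  exact: sigma_algebra_measurable.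
Qed.

Definition cell_indicator (n : nat) : borelType G -> R :=
  if @unpickle (nat * seq nat)%type n is Some p then \1_(cell p) else fun=> 0.

Lemma square_integrable_cell_indicator n : square_integrable mu (cell_indicator n).
Proof.
rewrite /cell_indicator; case: unpickle => [p|]; last exact: square_integrable0.
split; first by apply: measurable_indic; exact: borel_cell.
by rewrite sqint_indic; [exact: cell_lty|exact: borel_cell].
Qed.

(** The functions whose translate by a belongs to C form a closed subspace, so
    C contains the translates of all cell indicators along with those of the
    Gram-Schmidt vectors. *)
Lemma translates_gs_total (C : set (borelType G -> R)) : closed_subspace mu C ->
  (forall n a, a \in Gam -> C (fun x => gs mu cell_indicator n (x - a))) ->
  forall f, square_integrable mu f -> C f.
Proof.
move=> hC Ce f [mf foo].
apply: (closed_subspace_dense hC translated_cells_generate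
  translated_cells_setI translated_cells_lty translated_cells_basic
  bigcup_basic_cell _ mf foo) => A.
move=> [->|[a aG [p ->]]]; first by rewrite indic0; exact: (closed_subspace0 hC).
have hCa := closed_subspace_translate hC a.
have [n|_] := gs_generates square_integrable_cell_indicator hCa _ (pickle p).
  split; last exact: Ce.
  by have [] := square_integrable_gs square_integrable_cell_indicator n.
by rewrite /cell_indicator pickleK.
Qed.

Lemma gs_cell_vanish n x : ~ F x -> gs mu cell_indicator n x = 0.
Proof.
move=> nFx; apply: gs_vanish => k; rewrite /cell_indicator.
by case: unpickle => // p; rewrite indicE memNset// => /cell_transversal.
Qed.

End Cells.
End Density.

(** * The closed span of a family of functions *)

Section SpanClosure.
Context d (T : measurableType d) (R : realType).
Variable mu : {measure set T -> \bar R}.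
Variables (J : Type) (e : J -> T -> R).
Hypothesis me : forall j, measurable_fun setT (e j).

Definition combination (s : seq (R * J)) : T -> R :=
  fun x => \sum_(p <- s) p.1 * e p.2 x.

Definition span_closure : set (T -> R) :=
  [set f : T -> R | measurable_fun setT f /\
  forall eps : R, 0 < eps -> exists s,
    (sqint mu (fun x => f x - combination s x)%R < eps%:E)%E].

Lemma measurable_combination s : measurable_fun setT (combination s).
Proof.
elim: s => [|p s ih].
  by rewrite /combination; under eq_fun do rewrite big_nil; exact: measurable_cst.
rewrite /combination; under eq_fun do rewrite big_cons.
by apply: measurable_funD => //; exact: measurable_funM.
Qed.

Lemma combinationL a s t :
  exists u, forall x, combination u x = a * combination s x + combination t x.
Proof.
exists ([seq (a * p.1, p.2) | p <- s] ++ t) => x.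
rewrite /combination big_cat big_map /= mulr_sumr; congr (_ + _).
by apply: eq_bigr => p _; rewrite mulrA.
Qed.

Lemma span_closure_closed : closed_subspace mu span_closure.
Proof.
split.
- by move=> f [].
- split; first exact: measurable_cst.
  move=> eps eps0; exists [::].
  rewrite /sqint /combination; under eq_integral do rewrite big_nil subrr expr0n/=.
  by rewrite integral0 lte_fin.
- move=> a f g [mf fs] [mg gs].
  split; first by apply: measurable_funD => //; exact: measurable_funM.
  move=> eps eps0; pose k := 2 * (a ^+ 2 + 1) : R.
  have k0 : 0 < k by rewrite mulr_gt0// ltr_wpDl// sqr_ge0.
  have epsk0 : 0 < eps / (2 * k) by rewrite divr_gt0// mulr_gt0.
  (* The two approximations add up to 2 (a^2 + 1) eps / (2 k) = eps / 2. *)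
  have [s sP] := fs (eps / (2 * k)) epsk0.
  have [t tP] := gs (eps / (2 * k)) epsk0.
  have [u uE] := combinationL a s t; exists u.
  have mfs : measurable_fun setT (fun x => f x - combination s x).
    by apply: measurable_funB => //; exact: measurable_combination.
  have mgt : measurable_fun setT (fun x => g x - combination t x).
    by apply: measurable_funB => //; exact: measurable_combination.
  have := sqintD mu (measurable_funM (measurable_cst a) mfs) mgt.
  rewrite (_ : (fun x => _) = fun x => a * f x + g x - combination u x); last first.
    by apply/funext => x; rewrite uE /=; ring.
  move=> /le_lt_trans; apply; rewrite sqintZ//.
  have ha : ((a ^+ 2)%:E * sqint mu (fun x => f x - combination s x)%R <=
             (a ^+ 2 * (eps / (2 * k)))%:E)%E.
    by rewrite (EFinM (a ^+ 2)); apply: lee_pmul => //;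
      [rewrite lee_fin sqr_ge0|exact: sqint_ge0|exact: ltW].
  apply: (@le_lt_trans _ _ (2%:E * (a ^+ 2 * (eps / (2 * k)))%:E +
      2%:E * sqint mu (fun x => g x - combination t x)%R)%E).
    apply: leeD2r; apply: lee_pmul => //.
    by apply: mule_ge0; [rewrite lee_fin sqr_ge0|exact: sqint_ge0].
  apply: (@lt_le_trans _ _ (2%:E * (a ^+ 2 * (eps / (2 * k)))%:E +
      2%:E * (eps / (2 * k))%:E)%E).
    by rewrite lteD2lE ?lte_pmul2l// -EFinM.
  rewrite -!EFinM -EFinD lee_fin.
  have -> : 2 * (a ^+ 2 * (eps / (2 * k))) + 2 * (eps / (2 * k)) = eps / 2.
    have kn : k != 0 by rewrite gt_eqF.
    rewrite /k in kn *; field.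
    by move: kn; rewrite mulf_eq0 negb_or => /andP[].
  lra.
- move=> f mf fl; split => // eps eps0.
  have e4 : 0 < eps / 4 by rewrite divr_gt0.
  have [g [mg gs] fg] := fl _ e4; have [s sP] := gs _ e4; exists s.
  have mfg : measurable_fun setT (fun x => f x - g x) by exact: measurable_funB.
  have mgs : measurable_fun setT (fun x => g x - combination s x).
    by apply: measurable_funB => //; exact: measurable_combination.
  have := sqintD mu mfg mgs.
  rewrite (_ : (fun x => _) = fun x => f x - combination s x); last first.
    by apply/funext => x; rewrite addrA subrK.
  move=> /le_lt_trans; apply.
  apply: (@lt_le_trans _ _ (2%:E * (eps / 4)%:E + 2%:E * (eps / 4)%:E)%E).
    by apply: lteD; rewrite lte_pmul2l.
  rewrite -!EFinM -EFinD lee_fin; lra.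
Qed.

Lemma span_closure_gen j : span_closure (e j).
Proof.
split=> // eps eps0; exists [:: (1, j)].
rewrite /sqint /combination.
under eq_integral do rewrite big_seq1 mul1r subrr expr0n/=.
by rewrite integral0 lte_fin.
Qed.

End SpanClosure.

(** * From real to complex orthonormal bases *)

Section Complexification.
Context (R : realType) (G : topologicalZmodType)
  (mu : {measure set (borelType G) -> \bar R}).
Implicit Types f g : borelType G -> R.

Definition complexify f : borelType G -> R[i] := fun x => Complex (f x) 0.

Lemma L2norm_sqint (f : borelType G -> R[i]) :
  measurable_fun setT (fun x => complex.Re (f x)) ->
  measurable_fun setT (fun x => complex.Im (f x)) ->
  (L2norm mu f `^ 2 = sqint mu (fun x => complex.Re (f x)) +
                      sqint mu (fun x => complex.Im (f x)))%E.
Proof.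
move=> mr mi; rewrite /L2norm poweR_Lnorm// /sqint -ge0_integralD//; last 4 first.
- by move=> x _; rewrite lee_fin sqr_ge0.
- exact: measurable_sq.
- by move=> x _; rewrite lee_fin sqr_ge0.
- exact: measurable_sq.
apply: eq_integral => x _; case: (f x) => a b /=.
rewrite -EFinD ger0_norm ?sqrtr_ge0// powR_mulrn ?sqrtr_ge0//.
by rewrite sqr_sqrtr// addr_ge0 ?sqr_ge0.
Qed.

Lemma L2norm_ge0 (f : borelType G -> R[i]) : (0 <= L2norm mu f)%E.
Proof. exact: Lnorm_ge0. Qed.

Lemma L2E (f : borelType G -> R[i]) : L2 mu f <->
  square_integrable mu (fun x => complex.Re (f x)) /\
  square_integrable mu (fun x => complex.Im (f x)).
Proof.
split=> [[mr mi foo]|[[mr roo] [mi ioo]]].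
  have : (L2norm mu f `^ 2 < +oo)%E by exact: poweR_lty.
  rewrite L2norm_sqint// => h; split; split => //; apply: le_lt_trans h.
  - by rewrite leeDl// sqint_ge0.
  - by rewrite leeDr// sqint_ge0.
split=> //; have : (L2norm mu f `^ 2 < +oo)%E by rewrite L2norm_sqint// lte_add_pinfty.
by have := leey (L2norm mu f); rewrite le_eqVlt => /predU1P[->|//]; rewrite poweRyr.
Qed.

Lemma L2norm_lt (f : borelType G -> R[i]) (eps : R) : 0 < eps ->
  measurable_fun setT (fun x => complex.Re (f x)) ->
  measurable_fun setT (fun x => complex.Im (f x)) ->
  (sqint mu (fun x => complex.Re (f x)) < (eps ^+ 2 / 2)%:E)%E ->
  (sqint mu (fun x => complex.Im (f x)) < (eps ^+ 2 / 2)%:E)%E ->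
  (L2norm mu f < eps%:E)%E.
Proof.
move=> eps0 mr mi hr hi; rewrite ltNge; apply/negP => h.
have : ((eps%:E) `^ 2 <= L2norm mu f `^ 2)%E.
  by apply: gt0_ler_poweR => //; rewrite in_itv/= leey andbT ?L2norm_ge0// lee_fin ltW.
apply/negP; rewrite -ltNge L2norm_sqint// poweR_EFin powR_mulrn ?ltW//.
by rewrite (_ : eps ^+ 2 = eps ^+ 2 / 2 + eps ^+ 2 / 2) ?EFinD ?lteD//; field.
Qed.

Lemma L2_complexify f : square_integrable mu f -> L2 mu (complexify f).
Proof. by move=> sf; apply/L2E; split => //; exact: square_integrable0. Qed.

Lemma inner_complexify f g :
  inner mu (complexify f) (complexify g) = Complex (dot mu f g) 0.
Proof.
rewrite /inner /cintegral; congr Complex.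
  by apply: eq_Rintegral => x _ /=; rewrite mul0r subr0.
rewrite /Rintegral (_ : (fun x => _) = cst 0%E) ?integral0//.
by apply/funext => x /=; rewrite oppr0 mulr0 mul0r addr0.
Qed.

(** Real and imaginary parts are approximated separately; the coefficients of
    the second approximation are multiplied by the imaginary unit. *)
Lemma complexify_combination (J : Type) (e : J -> borelType G -> R) s t x :
  \sum_(p <- [seq (Complex q.1 0, q.2) | q <- s] ++
              [seq (Complex 0 q.1, q.2) | q <- t])
    p.1 * complexify (e p.2) x =
  Complex (combination e s x) (combination e t x).
Proof.
rewrite big_cat !big_map /= /combination.
elim: s => [|p s ih].
  rewrite !big_nil add0r; elim: t => [|p t ih]; first by rewrite !big_nil.
  rewrite !big_cons ih /complexify; apply/eqP; rewrite eq_complex /=.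
  by rewrite !mul0r !mulr0 subrr !add0r !eqxx.
rewrite !big_cons -addrA ih /complexify; apply/eqP; rewrite eq_complex /=.
by rewrite !mul0r !mulr0 subr0 !add0r !eqxx.
Qed.

Lemma orthonormal_basis_complexify (J : eqType) (e : J -> borelType G -> R) :
  (forall j, square_integrable mu (e j)) ->
  (forall j k, dot mu (e j) (e k) = (j == k)%:R) ->
  (forall f, square_integrable mu f -> span_closure mu e f) ->
  orthonormal_basis mu (fun j => complexify (e j)).
Proof.
move=> se de ce; split.
- by move=> j; exact: L2_complexify.
- by move=> j k; rewrite inner_complexify de; case: (j == k).
- move=> f /L2E[sr si] eps eps0.
  have eps2 : 0 < eps ^+ 2 / 2 by rewrite divr_gt0// exprn_gt0.
  have [mr /(_ _ eps2)[s sP]] := ce _ sr; have [mi /(_ _ eps2)[t tP]] := ce _ si.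
  exists ([seq (Complex q.1 0, q.2) | q <- s] ++
          [seq (Complex 0 q.1, q.2) | q <- t]).
  have me j : measurable_fun setT (e j) by have [] := se j.
  under eq_fun do rewrite complexify_combination.
  apply: L2norm_lt => //.
  + rewrite (_ : (fun x => _) =
        fun x => complex.Re (f x) - combination e s x); last first.
      by apply/funext => x; case: (f x).
    by apply: measurable_funB => //; exact: measurable_combination.
  + rewrite (_ : (fun x => _) =
        fun x => complex.Im (f x) - combination e t x); last first.
      by apply/funext => x; case: (f x).
    by apply: measurable_funB => //; exact: measurable_combination.
  + rewrite (_ : (fun x => _) = fun x => complex.Re (f x) - combination e s x)//.
    by apply/funext => x; case: (f x).
  + rewrite (_ : (fun x => _) = fun x => complex.Im (f x) - combination e t x)//.
    by apply/funext => x; case: (f x).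
Qed.

End Complexification.

(** * The generalized shift-invariant system *)

Lemma esum_pairs_le (R : realType) (P : pred (nat * nat))
    (a : nat * nat -> \bar R) (eps : R) : 0 <= eps ->
  (forall p, P p -> (a p <= (eps / (2 ^ p.1.+1)%:R / (2 ^ p.2.+1)%:R)%:E)%E) ->
  (\esum_(i in [set: {p | P p}]) a (val i) <= eps%:E)%E.
Proof.
move=> eps0 ab; pose b (p : nat * nat) : \bar R :=
  (eps / (2 ^ p.1.+1)%:R / (2 ^ p.2.+1)%:R)%:E.
have b0 p : (0 <= b p)%E by rewrite lee_fin !divr_ge0.
apply: (@le_trans _ _ (\esum_(i in [set: {p | P p}]) b (val i))).
  by apply: le_esum => -[p Pp] _; exact: ab.
rewrite -(@reindex_esum _ _ _ setT (range (val : {p | P p} -> _)) val b); last first.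
  split; [by move=> x _; exists x|by move=> x y _ _; exact: val_inj|by []].
rewrite esum_mkcond; apply: (@le_trans _ _ (\esum_(p in [set: nat * nat]) b p)).
  by apply: le_esum => p _; case: ifP.
have -> : [set: nat * nat] = [set: nat] `*`` (fun=> [set: nat]).
  by apply/seteqP; split.
rewrite -(@esum_esum _ _ _ _ _ (fun i j => b (i, j)))//.
apply: le_trans (epsilon_trick0 xpredT eps0).
rewrite nneseries_esumT; last by move=> n; rewrite lee_fin divr_ge0.
apply: le_esum => i _; rewrite -nneseries_esumT//.
by apply: (@epsilon_trick0 _ (eps / (2 ^ i.+1)%:R) xpredT); rewrite divr_ge0.
Qed.

Section GsiSystem.
Context (R : realType) (G : topologicalZmodType)
  (mu : {measure set (borelType G) -> \bar R}).
Hypotheses (scG : @second_countable G) (haar_mu : haar_measure mu).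
Variables (Gam : nat -> zmodClosed G).
Hypothesis decr : forall n, [set` Gam n.+1] `<` [set` Gam n].
Variables (g : nat -> G) (F : set G) (e : nat -> borelType G -> R) (c : nat).
Hypotheses (gG : forall n, g n \in Gam 0%N)
  (gsur : forall x, x \in Gam 0%N -> exists n, g n = x)
  (FT : exact_transversal (Gam 0%N) F)
  (se : forall n, square_integrable mu (e n))
  (eF : forall n x, ~ F x -> e n x = 0)
  (e01 : forall n, e n = (fun=> 0) \/ dot mu (e n) (e n) = 1)
  (eO : forall m n, m != n -> dot mu (e m) (e n) = 0).

(** A label (j, n) stands for the unit vector e j and the fresh coset of g n in
    the partition of level j + c; the zero vectors that the Gram-Schmidt
    process may output get no label.  That the level grows with j makes the
    densities of all these partitions summable. *)
Definition gsi_pred (p : nat * nat) : bool :=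
  (dot mu (e p.1) (e p.1) == 1) && fresh_coset Gam g (p.1 + c) p.2.

Definition gsi_label : countType := {p : nat * nat | gsi_pred p}.

Definition gsi_lattice (i : gsi_label) : zmodClosed G :=
  Gam ((val i).2 + ((val i).1 + c))%N.

Definition gsi_generator (i : gsi_label) : borelType G -> R :=
  fun x => e (val i).1 (x - g (val i).2).

Definition gsi_shift (j : gsi_index gsi_lattice) : G :=
  val (tagged j) + g (val (tag j)).2.

Definition gsi_function (j : gsi_index gsi_lattice) : borelType G -> R :=
  fun x => e (val (tag j)).1 (x - gsi_shift j).

Lemma gsi_systemE :
  gsi_system (Lam := gsi_lattice) (fun i => complexify (gsi_generator i)) =
  fun j => complexify (gsi_function j).
Proof.
apply/funext => j; apply/funext => x.
rewrite /gsi_system /translation /complexify /gsi_generator /gsi_function /gsi_shift.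
by congr (Complex (e _ _) _); rewrite opprD addrA.
Qed.

Lemma gsi_shift_mem j : gsi_shift j \in Gam 0%N.
Proof.
rewrite /gsi_shift rpredD//.
by apply: (chain_sub decr (leq0n _)); exact: (valP (tagged j)).
Qed.

(** For a fixed vector e j, the fresh cosets are disjoint: an element of Gam 0
    determines its coset and its position in the coset. *)
Lemma gsi_shift_inj j k : (val (tag j)).1 = (val (tag k)).1 ->
  gsi_shift j = gsi_shift k -> j = k.
Proof.
case: j => i [a aG]; case: k => i' [b bG]; rewrite /gsi_shift /= => ii ab.
have [/andP[_ fi] /andP[_ fi']] := (valP i, valP i').
have ii' : i = i'.
  apply: val_inj; rewrite [val i]surjective_pairing [val i']surjective_pairing.
  congr pair => //; rewrite -ii in fi'.
  apply: (fresh_cosets_disjoint decr fi fi' aG _ ab).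
  by move: bG; rewrite /gsi_lattice -ii.
move: bG ab; rewrite -ii' => bG /addIr ab.
by congr existT; exact: val_inj.
Qed.

Lemma square_integrable_gsi j : square_integrable mu (gsi_function j).
Proof. exact: square_integrable_translation. Qed.

(** Translates by distinct elements of Gam 0 have disjoint supports, and for a
    common translation the invariance of mu reduces to the functions e n. *)
Lemma dot_gsi j k : dot mu (gsi_function j) (gsi_function k) = (j == k)%:R.
Proof.
have [<-|jk] := eqVneq j k.
  rewrite dot_translation//; case: (tag j) => p /=.
  by rewrite /gsi_pred => /andP[/eqP].
have [ab|ab] := eqVneq (gsi_shift j) (gsi_shift k).
  rewrite /gsi_function -ab dot_translation// eO//.
  by apply: contra_neq jk => jk; exact: gsi_shift_inj.
rewrite /dot (_ : (fun x => _) = fun=> 0).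
  by rewrite /Rintegral integral0.
apply/funext => x; rewrite /gsi_function.
have [Fj|nFj] := pselect (F (x - gsi_shift j)); last by rewrite eF ?mul0r.
have [Fk|nFk] := pselect (F (x - gsi_shift k)); last first.
  by rewrite [e _ (_ - gsi_shift k)]eF ?mulr0.
have [_ _ FI] := FT.
have : gsi_shift k - gsi_shift j = 0.
  apply: (FI _ (x - gsi_shift j)) => //.
    by rewrite rpredB ?gsi_shift_mem.
  by rewrite opprB addrA subrK.
by move/eqP; rewrite subr_eq0 eq_sym (negbTE ab).
Qed.

Lemma gsi_span n a : a \in Gam 0%N ->
  span_closure mu gsi_function (fun x => e n (x - a)).
Proof.
have hC := span_closure_closed mu (fun j => (square_integrable_gsi j).1).
move=> aG; have [->|e1] := e01 n; first exact: (closed_subspace0 hC).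
have [m [b [fm bG ab]]] := fresh_cosets_cover decr (n + c) (gsur aG).
have nm : gsi_pred (n, m) by rewrite /gsi_pred /= e1 eqxx.
pose j : gsi_index gsi_lattice :=
  existT _ (exist _ (n, m) nm : gsi_label) (exist _ b bG).
have := span_closure_gen mu (fun j => (square_integrable_gsi j).1) j.
by rewrite /gsi_function /gsi_shift /= -ab.
Qed.

(** The density of the label (j, n) is at most eps / 2 ^ (j + 1) / 2 ^ (n + 1);
    the factor 4 in the last hypothesis comes from the two increments. *)
Lemma BW_gsi (c0 eps : R) : 0 < c0 -> 0 < eps ->
  (forall m, ((c0 * 2 ^+ m)%:E <= covol mu (Gam m))%E) ->
  (c0 ^-1 * 4 <= eps * 2 ^+ c) ->
  (BW mu gsi_lattice <= eps%:E)%E.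
Proof.
move=> c00 eps0 hc hcc; rewrite /BW /gsi_lattice.
apply: (@esum_pairs_le R gsi_pred
  (fun p => (covol mu (Gam (p.2 + (p.1 + c))%N))^-1%E)); first exact: ltW.
move=> [m n] _ /=.
have h2 k : 0 < 2 ^+ k :> R by rewrite exprn_gt0.
have ch k : 0 < c0 * 2 ^+ k by rewrite mulr_gt0.
apply: (@le_trans _ _ ((c0 * 2 ^+ (n + (m + c)))%:E^-1)%E).
  rewrite lee_pV2// inE /=; last by rewrite lee_fin ltW.
  by apply: le_trans (hc _); rewrite lee_fin ltW.
rewrite inver gt_eqF// lee_fin !natrX !exprS !exprD.
set x := 2 ^+ n; set y := 2 ^+ m; set z := 2 ^+ c.
have [x0 y0 z0] : [/\ 0 < x, 0 < y & 0 < z] by rewrite !h2.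
have -> : (c0 * (x * (y * z)))^-1 = (c0^-1 * 4) * (4 * x * y * z)^-1.
  by field; rewrite !gt_eqF.
have -> : eps / (2 * y) / (2 * x) = (eps * z) * (4 * x * y * z)^-1.
  by field; rewrite !gt_eqF.
by apply: ler_wpM2r => //; rewrite invr_ge0 !mulr_ge0// ltW.
Qed.

End GsiSystem.

Theorem theorem4p1 (R : realType) (G : topologicalZmodType)
    (hausG : hausdorff_space G) (lcG : locally_compact [set: G])
    (scG : @second_countable G)
    (mu : {measure set (borelType G) -> \bar R}) (haar_mu : haar_measure mu)
    (Gam : nat -> zmodClosed G)
    (lattice_Gam : forall n, lattice (Gam n))
    (decr_Gam : forall n, [set` Gam n.+1] `<` [set` Gam n])
    (eps : R) (eps_gt0 : 0 < eps) :
  exists (I : countType) (Lam : I -> zmodClosed G)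
         (h : I -> borelType G -> R[i]),
    [/\ forall i, lattice (Lam i),
        (BW mu Lam < eps%:E)%E,
        forall i, L2 mu (h i) &
        orthonormal_basis mu (gsi_system (Lam := Lam) h)].
Proof.
have dGam n : discrete_subgroup (Gam n) by have [] := lattice_Gam n.
have [F FT] := exists_transversal scG (dGam 0%N).
have [g [gG gsur]] := discrete_countable scG (dGam 0%N).
have [B [oB Boo bB]] := finite_measure_base lcG scG haar_mu.
have [c0 c00 hc] := covol_exponential scG haar_mu dGam decr_Gam.
have [c cP] : exists c, c0 ^-1 * 4 <= eps / 2 * 2 ^+ c.
  exists (Num.bound (c0 ^-1 * 4 / (eps / 2))).
  rewrite -ler_pdivrMl ?divr_gt0// mulrC.
  have b0 : 0 <= c0^-1 * 4 / (eps / 2) by rewrite !mulr_ge0 ?invr_ge0 ?ltW ?divr_gt0.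
  apply: (le_trans (ltW (archi_boundP b0))).
  by rewrite -natrX ler_nat ltnW// ltn_expl.
pose u := cell_indicator R F B.
have su n : square_integrable mu (u n).
  exact: square_integrable_cell_indicator FT oB Boo n.
pose e := gs mu u.
have se n : square_integrable mu (e n) by exact: square_integrable_gs.
have e01 n : e n = (fun=> 0) \/ dot mu (e n) (e n) = 1 by exact: gs_eq0_or_unit.
have eO m n : m != n -> dot mu (e m) (e n) = 0 by exact: dot_gs.
have eF n x : ~ F x -> e n x = 0 by exact: gs_cell_vanish.
exists (gsi_label mu Gam g e c), (@gsi_lattice _ _ mu Gam g e c),
  (fun i => complexify (@gsi_generator _ _ mu Gam g e c i)); split.
- by move=> i; exact: lattice_Gam.
- apply: (@le_lt_trans _ _ (eps / 2)%:E); last by rewrite lte_fin; lra.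
  by apply: (BW_gsi _ _ c00 _ hc cP); rewrite divr_gt0.
- by move=> i; apply: L2_complexify; exact: square_integrable_translation.
- rewrite gsi_systemE; apply: orthonormal_basis_complexify.
  + by move=> j; exact: square_integrable_gsi.
  + by move=> j k; exact: (dot_gsi _ _ _ FT).
  + move=> f sf; apply: (translates_gs_total haar_mu gG gsur FT oB Boo bB _ _ sf).
      apply: span_closure_closed => j.
      by have [] := square_integrable_gsi haar_mu se j.
    by move=> n a aG; exact: gsi_span.
Qed.
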